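(* Internally in $\mathbf{Eff}$, every function $\Omega\to\Omega$ is an $N$-indexed join of functions in the image of the map $\mathrm{gr}_{(-)}:\nabla(\mathcal P(\mathcal P(\mathbb N)))\to\Omega^\Omega$, where $N$ is the natural numbers object; that is, $$\mathbf{Eff}\models\forall h\in\Omega^\Omega\ \exists\theta\in\nabla(\mathcal P(\mathcal P(\mathbb N)))^N.\ h=\bigvee_{n\in N}\mathrm{gr}_{\theta(n)}.$$
   Context: $\mathbf{Eff}$ is the effective topos, obtained by the tripos-to-topos construction from the effective tripos (predicates on a set $X$ are functions $X\to\mathcal P(\mathbb N)$, with $r\le s$ iff $\bigcap_{x\in X}(r(x)\Rightarrow s(x))\neq\emptyset$). Here $\mathcal P(X)$ is the power set, $e(n)$ is the possibly undefined value at $n$ of the $e$-th partial recursive function, $\langle\cdot,\cdot\rangle$ a recursive pairing, and for $A,B\subseteq\mathbb N$: $A\Rightarrow B=\{e:\forall a\in A,\ e(a)\text{ defined and in }B\}$, $A\wedge B=\{\langle a,b\rangle:a\in A,b\in B\}$, $A\Leftrightarrow B=(A\Rightarrow B)\wedge(B\Rightarrow A)$. The subobject classifier $\Omega$ is $(\mathcal P(\mathbb N),\Leftrightarrow)$. $\Omega^\Omega$ is represented by the set of functions $h:\mathcal P(\mathbb N)\to\mathcal P(\mathbb N)$, with existence predicate $\mathrm{ext}(h)=\bigcap_{p,q}\big((p\Leftrightarrow q)\Rightarrow(h(p)\Leftrightarrow h(q))\big)$ and equality given by $\mathrm{ext}(h)\wedge\bigcap_p(h(p)\Leftrightarrow h'(p))$.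 $\Omega^\Omega$ is internally ordered pointwise, so $(\bigvee_{n\in N}h_n)(p)$ is $\exists n\in N.\,h_n(p)$; the natural numbers object $N$ is $\mathbb N$ with existence predicate $n\mapsto\{n\}$. For a set $X$, $\nabla(X)$ is $X$ with the equality predicate equal to $\mathbb N$ if $x=x'$ and $\emptyset$ otherwise. For $\mathcal A\in\mathcal P(\mathcal P(\mathbb N))$, $\mathrm{gr}_{\mathcal A}:\mathcal P(\mathbb N)\to\mathcal P(\mathbb N)$ is $\mathrm{gr}_{\mathcal A}(p)=\bigcup_{A\in\mathcal A}(A\Leftrightarrow p)$; the function $\mathcal A\mapsto\mathrm{gr}_{\mathcal A}$ represents the map $\mathrm{gr}_{(-)}:\nabla(\mathcal P(\mathcal P(\mathbb N)))\to\Omega^\Omega$. *)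

(* Defs.v *)
From Stdlib Require Cantor.
From mathcomp Require Import all_boot boolp classical_sets.

Set Implicit Arguments.
Unset Strict Implicit.
Unset Printing Implicit Defensive.

Local Open Scope classical_set_scope.

(** * Partial recursive functions *)

(* Cantor's bijection nat * nat -> nat. *)
Definition npair (a b : nat) : nat := Cantor.to_nat (a, b).
Definition nfst (n : nat) : nat := (Cantor.of_nat n).1.
Definition nsnd (n : nat) : nat := (Cantor.of_nat n).2.

Lemma nfstK a b : nfst (npair a b) = a.
Proof. by rewrite /nfst /npair Cantor.cancel_of_to. Qed.

Lemma nsndK a b : nsnd (npair a b) = b.
Proof. by rewrite /nsnd /npair Cantor.cancel_of_to. Qed.

Lemma npairK n : npair (nfst n) (nsnd n) = n.
Proof.
by rewrite /nfst /nsnd /npair -surjective_pairing Cantor.cancel_to_of.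
Qed.

Lemma npair_inj a b c d : npair a b = npair c d -> a = c /\ b = d.
Proof. by move=> E; rewrite -(nfstK a b) -{2}(nsndK a b) E nfstK nsndK. Qed.

(* Programs for the unary partial recursive functions; functions of several
   arguments are unary functions of an iterated pair. *)
Inductive code : Type :=
| CZero
| CSucc
| CFst
| CSnd
| CPair of code & code
| CComp of code & code
| CPrec of code & code
| CMu of code.

(* A partial function nat -> nat is given by its graph. *)
Fixpoint primrec (F G : nat -> nat -> Prop) (a n y : nat) : Prop :=
  match n with
  | 0 => F a y
  | n'.+1 => exists2 u, primrec F G a n' u & G (npair a (npair n' u)) y
  end.

(* [ceval c x y]: the program c terminates on input x with output y. *)
Fixpoint ceval (c : code) (x y : nat) {struct c} : Prop :=
  match c with
  | CZero => y = 0
  | CSucc => y = x.+1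
  | CFst => y = nfst x
  | CSnd => y = nsnd x
  | CPair f g => exists u v, [/\ ceval f x u, ceval g x v & y = npair u v]
  | CComp f g => exists2 u, ceval g x u & ceval f u y
  | CPrec f g => primrec (ceval f) (ceval g) (nfst x) (nsnd x) y
  | CMu f => ceval f (npair x y) 0 /\
             forall m, m < y -> exists k, ceval f (npair x m) k.+1
  end.

Lemma ceval_fun c x y z : ceval c x y -> ceval c x z -> y = z.
Proof.
elim: c x y z => [||||f IHf g IHg|f IHf g IHg|f IHf g IHg|f IHf] x y z /=;
  try by move=> -> ->.
- by move=> [u [v [/IHf fu /IHg gv ->]]] [u' [v' [/fu <- /gv <- ->]]].
- by move=> [u /IHg gu /IHf fy] [u' /gu <- /fy].
- elim: (nsnd x) y z => [|n IHn] y z /=; first exact: IHf.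
  by move=> [u /IHn nu /IHg gy] [u' /nu <- /gy].
- move=> [fy y_min] [fz z_min].
  case: (ltngtP y z) => // [/z_min|/y_min] [k fk].
    by have := IHf _ _ _ fy fk.
  by have := IHf _ _ _ fz fk.
Qed.

Fixpoint code_num (c : code) : nat :=
  match c with
  | CZero => npair 0 0
  | CSucc => npair 1 0
  | CFst => npair 2 0
  | CSnd => npair 3 0
  | CPair f g => npair 4 (npair (code_num f) (code_num g))
  | CComp f g => npair 5 (npair (code_num f) (code_num g))
  | CPrec f g => npair 6 (npair (code_num f) (code_num g))
  | CMu f => npair 7 (code_num f)
  end.

Lemma code_num_inj : injective code_num.
Proof.
elim=> [||||f IHf g IHg|f IHf g IHg|f IHf g IHg|f IHf] [||||f' g'|f' g'|f' g'|f']
  //= /npair_inj[] // _; try by move=> /npair_inj[/IHf -> /IHg ->].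
by move=> /IHf ->.
Qed.

(* [app e a b]: e(a) is defined with value b, where e(-) is the e-th partial
   recursive function; numbers that are not of the form [code_num c] index
   the nowhere defined function. *)
Definition app (e a b : nat) : Prop :=
  exists2 c, code_num c = e & ceval c a b.

Lemma app_fun e a b b' : app e a b -> app e a b' -> b = b'.
Proof.
by move=> [c <- cb] [c' /code_num_inj -> cb']; apply: ceval_fun cb cb'.
Qed.

(** * The effective tripos *)

Definition rimp (A B : set nat) : set nat :=
  [set e | forall a, A a -> exists2 b, app e a b & B b].

Definition rand (A B : set nat) : set nat :=
  [set n | exists a b, [/\ A a, B b & n = npair a b]].

Definition riff (A B : set nat) : set nat := rand (rimp A B) (rimp B A).

Definition tripos_le (X : Type) (r s : X -> set nat) : Prop :=
  (\bigcap_x rimp (r x) (s x)) !=set0.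

(* A closed formula is interpreted as a predicate on the one-point set, and
   holds when it lies above the top predicate. *)
Definition Eff_models (phi : set nat) : Prop :=
  @tripos_le unit (fun=> setT) (fun=> phi).

(** * Presentations of objects of the effective topos *)

(* A set with its existence predicate and its P(nat)-valued equality.  Where no
   other existence predicate is given, it is the diagonal of the equality.  Only this
   data enters truth values, so that the equality is symmetric and transitive
   (up to realizers) is not made part of the record. *)
Record eff_obj : Type := EffObj {
  carrier :> Type;
  exist : carrier -> set nat;
  equal : carrier -> carrier -> set nat }.
Arguments exist : clear implicits.
Arguments equal : clear implicits.

Definition eff_obj_of (X : Type) (eqX : X -> X -> set nat) : eff_obj :=
  EffObj (fun x => eqX x x) eqX.

Definition rforall (X : eff_obj) (phi : X -> set nat) : set nat :=
  \bigcap_x rimp (exist X x) (phi x).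

Definition rexists (X : eff_obj) (phi : X -> set nat) : set nat :=
  \bigcup_x rand (exist X x) (phi x).

Definition NNO : eff_obj :=
  eff_obj_of (fun n m : nat => [set k | k = n /\ n = m]).

Definition nabla (X : Type) : eff_obj :=
  eff_obj_of (fun x x' : X => [set _ : nat | x = x']).

Definition ext (h : set nat -> set nat) : set nat :=
  \bigcap_p \bigcap_q rimp (riff p q) (riff (h p) (h q)).

Definition OmegaOmega : eff_obj :=
  EffObj ext (fun h h' => rand (ext h) (\bigcap_p riff (h p) (h' p))).

(* The exponential Y^X of the tripos-to-topos construction: its elements are
   the P(nat)-valued relations F from X to Y, and F exists to the extent that
   it is a functional relation.  For theta in Y^X, the truth value of
   "theta(x) = y" is [theta x y]. *)
Section Exponential.
Variables X Y : eff_obj.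
Implicit Types F : X -> Y -> set nat.

Definition strict F : set nat :=
  \bigcap_x \bigcap_y rimp (F x y) (rand (exist X x) (exist Y y)).

Definition relational F : set nat :=
  \bigcap_x \bigcap_x' \bigcap_y \bigcap_y'
    rimp (rand (F x y) (rand (equal X x x') (equal Y y y'))) (F x' y').

Definition single_valued F : set nat :=
  \bigcap_x \bigcap_y \bigcap_y' rimp (rand (F x y) (F x y')) (equal Y y y').

Definition total F : set nat :=
  \bigcap_x rimp (exist X x) (\bigcup_y F x y).

Definition functional F : set nat :=
  rand (strict F) (rand (relational F) (rand (single_valued F) (total F))).

Definition exponential : eff_obj :=
  EffObj functional
    (fun F F' => rand (functional F) (\bigcap_x \bigcap_y riff (F x y) (F' x y))).

(* The truth value of phi(theta(x)) for a predicate phi on Y: there is y in Y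
   with theta(x) = y and phi(y). *)
Definition at_value (theta : exponential) (x : X) (phi : Y -> set nat) :
    set nat :=
  rexists (fun y : Y => rand (theta x y) (phi y)).

End Exponential.

Definition gr (A : set (set nat)) (p : set nat) : set nat :=
  \bigcup_(a in A) riff a p.

(* The join of an internal N-indexed family of functions Omega -> Omega. *)
Definition joinN (f : nat -> set nat -> set nat) (p : set nat) : set nat :=
  rexists (X := NNO) (fun n => f n p).

(* gr_{theta(n)}, as a function Omega -> Omega. *)
Definition gr_at (theta : exponential NNO (nabla (set (set nat)))) (n : nat)
    (p : set nat) : set nat :=
  at_value theta n (fun A : nabla (set (set nat)) => gr A p).

(* Main.v *)
Require Import Defs.
From mathcomp Require Import all_boot boolp classical_sets.

(** Let [theta n] be the set of all [A] with [n \in h A]. If [n \in h p], then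
    [p \in theta n] and the identity realizes [p <=> p], so that [n] with the
    identity realizes [exists n, gr (theta n) p]. Conversely, if [n \in h A] and
    [u] realizes [A <=> p], then a realizer [e] of [ext h] yields a realizer
    [e u] of [h A <=> h p], whose first component sends [n] into [h p]. That
    component is a program found at run time, so the converse requires a
    universal program; it is obtained from a stack machine whose step function
    is computable and which simulates all programs. *)

Set Implicit Arguments.
Unset Strict Implicit.
Unset Printing Implicit Defensive.

Arguments npair : simpl never.
Arguments nfst : simpl never.
Arguments nsnd : simpl never.

(** * Total computable functions *)

Definition computable (f : nat -> nat) : Prop :=
  exists c, forall x, ceval c x (f x).

Lemma computable_ext f g : f =1 g -> computable f -> computable g.
Proof. by move=> fg [c cf]; exists c => x; rewrite -fg. Qed.

Lemma computable_comp f g :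
  computable f -> computable g -> computable (fun x => f (g x)).
Proof. by move=> [c cf] [d dg]; exists (CComp c d) => x /=; exists (g x). Qed.

Lemma computable_fst f : computable f -> computable (fun x => nfst (f x)).
Proof. by apply: (computable_comp (f := nfst)); exists CFst. Qed.

Lemma computable_snd f : computable f -> computable (fun x => nsnd (f x)).
Proof. by apply: (computable_comp (f := nsnd)); exists CSnd. Qed.

Lemma computable_succ f : computable f -> computable (fun x => (f x).+1).
Proof. by apply: (computable_comp (f := succn)); exists CSucc. Qed.

Lemma computable_pair f g :
  computable f -> computable g -> computable (fun x => npair (f x) (g x)).
Proof.
by move=> [c cf] [d dg]; exists (CPair c d) => x /=; exists (f x), (g x).
Qed.

Definition code_id : code := CPair CFst CSnd.

Lemma ceval_id x : ceval code_id x x.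
Proof. by exists (nfst x), (nsnd x); rewrite npairK. Qed.

Lemma computable_id : computable id.
Proof. by exists code_id; apply: ceval_id. Qed.

Definition code_const (k : nat) : code := iter k (CComp CSucc) CZero.

Lemma ceval_const k x : ceval (code_const k) x k.
Proof. by elim: k => [|k IHk] //=; exists k. Qed.

Lemma computable_const k : computable (fun=> k).
Proof. by exists (code_const k) => x; apply: ceval_const. Qed.

Lemma computable_rec f g t : computable f -> computable g -> computable t ->
  computable (fun x =>
    nat_rect _ (f x) (fun i u => g (npair x (npair i u))) (t x)).
Proof.
move=> [c cf] [d dg] [e et].
exists (CComp (CPrec c d) (CPair code_id e)) => x /=.
exists (npair x (t x)); first by exists x, (t x); split=> //; exact: ceval_id.
rewrite nfstK nsndK; elim: (t x) => [|n IHn] //=.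
by eexists; [exact: IHn | exact: dg].
Qed.

(** The recursion discards its previous value and returns the round index: after [n.+1] rounds this
    is [n], and no round gives 0. *)
Lemma computable_pred f : computable f -> computable (fun x => (f x).-1).
Proof.
move=> cf; have cg : computable (fun y => nfst (nsnd y)).
  exact/computable_fst/computable_snd/computable_id.
apply: computable_ext (computable_rec (computable_const 0) cg cf) => x /=.
by case: (f x) => //= n; rewrite nsndK nfstK.
Qed.

(** A recursion whose step ignores the previous value: any positive number of rounds yields
    [g x]. *)
Lemma computable_case t f g :
  computable t -> computable f -> computable g ->
  computable (fun x => if t x is 0 then f x else g x).
Proof.
move=> ct cf cg; have cg' := computable_comp cg (computable_fst computable_id).
apply: computable_ext (computable_rec cf cg' ct) => x /=.
by case: (t x) => //= n; rewrite nfstK.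
Qed.

Lemma computable_iter f n s : computable f -> computable n -> computable s ->
  computable (fun x => iter (n x) f (s x)).
Proof.
move=> cf cn cs.
have cf' : computable (fun y => f (nsnd (nsnd y))).
  exact/(computable_comp cf)/computable_snd/computable_snd/computable_id.
apply: computable_ext (computable_rec cs cf' cn) => x /=.
by elim: (n x) => //= m ->; rewrite !nsndK.
Qed.

Lemma computable_nth bs t :
  foldr (fun b P => computable b /\ P) True bs -> computable t ->
  computable (fun x => nth id bs (t x) x).
Proof.
elim: bs t => [|b bs IHbs] t /=.
  move=> _ _; apply: computable_ext computable_id => x; by rewrite nth_nil.
move=> [cb cbs] ct.
apply: computable_ext
  (computable_case ct cb (IHbs _ cbs (computable_pred ct))) => x.
by case: (t x).
Qed.

(** * A universal program *)

(* A state is a current value paired with a stack of instructions; the empty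
   stack is 0. An instruction is a tag paired with an argument: tags up to 7
   are those of [code_num], so that the number of a program is itself the
   instruction to apply it to the current value. *)
Definition push (i s : nat) : nat := (npair i s).+1.

Definition top (z : nat) : nat := nfst (nsnd z).-1.
Definition rest (z : nat) : nat := nsnd (nsnd z).-1.
Definition arg (z : nat) : nat := nsnd (top z).

(* The second component of a pair remains to be computed: [g] at [x]. *)
Definition pair_right (g x : nat) : nat := npair 8 (npair g x).
Definition pair_with (u : nat) : nat := npair 9 u.
(* [i] is the index of the current value, [r] the number of rounds left. *)
Definition prec_loop (g a i r : nat) : nat :=
  npair 10 (npair g (npair a (npair i r))).
Definition mu_loop (f x m : nat) : nat := npair 11 (npair f (npair x m)).

Definition prec_step (z : nat) : nat :=
  let g := nfst (arg z) in
  let a := nfst (nsnd (arg z)) in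
  let i := nfst (nsnd (nsnd (arg z))) in
  let r := nsnd (nsnd (nsnd (arg z))) in
  if r is 0 then npair (nfst z) (rest z) else
  npair (npair a (npair i (nfst z)))
        (push g (push (prec_loop g a i.+1 r.-1) (rest z))).

Definition mu_step (z : nat) : nat :=
  let f := nfst (arg z) in
  let x := nfst (nsnd (arg z)) in
  let m := nsnd (nsnd (arg z)) in
  if nfst z is 0 then npair m (rest z) else
  npair (npair x m.+1) (push f (push (mu_loop f x m.+1) (rest z))).

(** The position of a branch is the tag it executes: 0 to 7 for programs, 8 to 11 for [pair_right],
    [pair_with], [prec_loop] and [mu_loop]. *)
Definition branches : seq (nat -> nat) := [::
  fun z => npair 0 (rest z);
  fun z => npair (nfst z).+1 (rest z);
  fun z => npair (nfst (nfst z)) (rest z);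
  fun z => npair (nsnd (nfst z)) (rest z);
  fun z => npair (nfst z)
    (push (nfst (arg z)) (push (pair_right (nsnd (arg z)) (nfst z)) (rest z)));
  fun z => npair (nfst z)
    (push (nsnd (arg z)) (push (nfst (arg z)) (rest z)));
  fun z => npair (nfst (nfst z))
    (push (nfst (arg z))
      (push (prec_loop (nsnd (arg z)) (nfst (nfst z)) 0 (nsnd (nfst z)))
        (rest z)));
  fun z => npair (npair (nfst z) 0)
    (push (arg z) (push (mu_loop (arg z) (nfst z) 0) (rest z)));
  fun z => npair (nsnd (arg z))
    (push (nfst (arg z)) (push (pair_with (nfst z)) (rest z)));
  fun z => npair (npair (arg z) (nfst z)) (rest z);
  prec_step;
  mu_step].

Definition step (z : nat) : nat :=
  if nsnd z is 0 then z else nth id branches (nfst (top z)) z.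

Lemma computable_step : computable step.
Proof.
have cv := computable_fst computable_id.
have cp := computable_pred (computable_snd computable_id).
have ctop : computable top := computable_fst cp.
have crest : computable rest := computable_snd cp.
have carg : computable arg := computable_snd ctop.
have ck := computable_const.
have cpush f g (cf : computable f) (cg : computable g) :
  computable (fun x => push (f x) (g x)) := computable_succ (computable_pair cf cg).
apply: computable_case; first exact/computable_snd/computable_id.
  exact: computable_id.
apply: computable_nth; last exact: computable_fst.
by do ![split | apply: computable_case | apply: cpush | apply: computable_pair
       | apply: computable_succ | apply: ck | apply: cv | apply: crest
       | apply: carg | apply: computable_fst | apply: computable_snd
       | apply: computable_pred].
Qed.

Lemma rest_push v i s : rest (npair v (push i s)) = s.
Proof. by rewrite /rest nsndK nsndK. Qed.

Lemma arg_push v t b s : arg (npair v (push (npair t b) s)) = b.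
Proof. by rewrite /arg /top nsndK nfstK nsndK. Qed.

Lemma step_push v t b s (z := npair v (push (npair t b) s)) :
  step z = nth id branches t z.
Proof. by rewrite /z /step /top nsndK /= !nfstK. Qed.

(** * Simulation of programs by the stack machine *)

Definition reaches (z z' : nat) : Prop := exists n, iter n step z = z'.

Lemma reaches_refl z : reaches z z.
Proof. by exists 0. Qed.

Lemma reaches_trans z2 z1 z3 : reaches z1 z2 -> reaches z2 z3 -> reaches z1 z3.
Proof. by move=> [m <-] [n <-]; exists (n + m); rewrite iterD. Qed.

Lemma reaches_step z z' : reaches (step z) z' -> reaches z z'.
Proof. by apply: reaches_trans; exists 1. Qed.

Ltac machine_step :=
  apply: reaches_step;
  rewrite step_push /= ?/prec_step ?/mu_step
    ?(rest_push, arg_push, nfstK, nsndK) /=.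

(** By induction on [c]; the stack [s] is arbitrary so that subprograms can run above the
    instructions still pending. *)
Lemma ceval_reaches c x y s :
  ceval c x y -> reaches (npair x (push (code_num c) s)) (npair y s).
Proof.
elim: c x y s => [||||f IHf g IHg|f IHf g IHg|f IHf g IHg|f IHf] x y s /=.
- by move=> ->; machine_step; apply: reaches_refl.
- by move=> ->; machine_step; apply: reaches_refl.
- by move=> ->; machine_step; apply: reaches_refl.
- by move=> ->; machine_step; apply: reaches_refl.
- move=> [u [v [fu gv ->]]]; machine_step.
  apply: reaches_trans (IHf _ _ _ fu) _; machine_step.
  apply: reaches_trans (IHg _ _ _ gv) _; machine_step.
  exact: reaches_refl.
- move=> [u gu fy]; machine_step.
  by apply: reaches_trans (IHg _ _ _ gu) _; apply: IHf.
- move=> fgy; machine_step; move: fgy; set a := nfst x.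
  (* [primrec] unfolds from the last round, the machine runs from the first. *)
  suff loop n r y' : primrec (ceval f) (ceval g) a n y' ->
      reaches (npair a (push (code_num f)
                (push (prec_loop (code_num g) a 0 (n + r)) s)))
              (npair y' (push (prec_loop (code_num g) a n r) s)).
    move=> /(loop _ 0); rewrite addn0 => loop_y.
    apply: reaches_trans loop_y _; machine_step; exact: reaches_refl.
  elim: n r y' => [|n IHn] r y' /=; first exact: IHf.
  move=> [u nu gy]; rewrite addSnnS.
  apply: reaches_trans (IHn r.+1 _ nu) _; machine_step.
  exact: IHg gy.
- move=> [fy y_min]; machine_step.
  (* Every candidate below [y] gives a successor value, so the machine moves on to the next one. *)
  have loop m : m <= y -> reaches
      (npair (npair x 0) (push (code_num f) (push (mu_loop (code_num f) x 0) s)))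
      (npair (npair x m) (push (code_num f) (push (mu_loop (code_num f) x m) s))).
    elim: m => [|m IHm] ltmy; first exact: reaches_refl.
    have [k fk] := y_min _ ltmy.
    apply: reaches_trans (IHm (ltnW ltmy)) _.
    by apply: reaches_trans (IHf _ _ _ fk) _; machine_step; apply: reaches_refl.
  apply: reaches_trans (loop y (leqnn y)) _.
  by apply: reaches_trans (IHf _ _ _ fy) _; machine_step; apply: reaches_refl.
Qed.

Lemma iter_step_halted n z : nsnd z = 0 -> iter n step z = z.
Proof. by move=> z0; elim: n => //= n ->; rewrite /step z0. Qed.

(** As in Kleene's normal form: minimisation finds the first time at which the stack is empty, and
    the current value at that time is the output. *)
Lemma universal_code :
  exists c, forall e a b, app e a b -> ceval c (npair e a) b.
Proof.
(* Here [w] encodes [npair (npair e a) k], with [k] the number of machine steps. *)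
pose run w := iter (nsnd w) step
  (npair (nsnd (nfst w)) (push (nfst (nfst w)) 0)).
have crun : computable run.
  apply: computable_iter; first exact: computable_step.
    exact/computable_snd/computable_id.
  have c1 := computable_fst computable_id.
  by apply: computable_pair; [exact: computable_snd | apply/computable_succ];
     apply: computable_pair; [exact: computable_fst | exact: computable_const].
have [halt cH] := computable_snd crun.
have [out cO] := computable_fst crun.
exists (CComp out (CPair code_id (CMu halt))) => _ a b [c <- cab].
have [n] := ceval_reaches 0 cab; set x := npair _ a; set z := npair a _ => run_n.
have runE k : run (npair x k) = iter k step z.
  by rewrite /run !nsndK !nfstK nsndK.
have halts : exists k, nsnd (iter k step z) == 0.
  by exists n; rewrite run_n nsndK.
case: (ex_minnP halts) => m /eqP halt_m m_min.
have le_mn : m <= n by apply: m_min; rewrite run_n nsndK.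
exists (npair x m).
  exists x, m; split=> //; first exact: ceval_id.
  split; first by have := cH (npair x m); rewrite runE halt_m.
  move=> k lt_km; exists (nsnd (iter k step z)).-1.
  rewrite prednK; first by rewrite -runE.
  by rewrite lt0n; apply: contraL lt_km => /m_min; rewrite -leqNgt.
(* The least halting time [m] may precede [n], but [step] fixes halted states, so both times give
   the same output. *)
have := cO (npair x m); rewrite runE.
by rewrite -(iter_step_halted (n - m) halt_m) -iterD subnK // run_n nfstK.
Qed.

(** * Currying of programs: the s-m-n theorem *)

Definition curry (c : code) (e : nat) : code :=
  CComp c (CPair (code_const e) code_id).

Lemma ceval_curry c e x y : ceval c (npair e x) y -> ceval (curry c e) x y.
Proof.
move=> cy; exists (npair e x) => //.
by exists e, x; split=> //; [exact: ceval_const | exact: ceval_id].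
Qed.

(** Only the number of [code_const e] varies with [e]; it arises by [e] iterations of [succ_after],
    which acts on numbers as [CComp CSucc] does on programs. *)
Lemma computable_curry c : computable (fun e => code_num (curry c e)).
Proof.
do 3 ![apply: computable_pair; first exact: computable_const].
apply: computable_pair; last exact: computable_const.
pose succ_after k := npair 5 (npair (npair 1 0) k).
have csucc : computable succ_after.
  by do 2 ![apply: computable_pair; first exact: computable_const];
     exact: computable_id.
apply: computable_ext (computable_iter csucc computable_id
  (computable_const (code_num CZero))) => e.
by rewrite /code_const; elim: e => //= e ->.
Qed.

(** * Realizers *)

Lemma rimp_code c (A B : set nat) :
  (forall a, A a -> exists2 b, ceval c a b & B b) -> rimp A B (code_num c).
Proof.
by move=> cAB a /cAB[b cab Bb]; exists b => //; exists c.
Qed.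

(** The realizer is chosen before [A] and [B], as the intersections over [h] and [p] demand. *)
Lemma rimp_computable f : computable f ->
  exists r, forall A B : set nat, (forall a, A a -> B (f a)) -> rimp A B r.
Proof.
move=> [c cf]; exists (code_num c) => A B fAB; apply: rimp_code => a Aa.
by exists (f a) => //; exact: fAB.
Qed.

Lemma rimp_id (A : set nat) : rimp A A (code_num code_id).
Proof. by apply: rimp_code => a Aa; exists a => //; apply: ceval_id. Qed.

Lemma rand_npair (A B : set nat) a b : A a -> B b -> rand A B (npair a b).
Proof. by exists a, b. Qed.

(** The graph of the family [theta], realized at [n] by [n] itself, just as the existence of [n] in
    [NNO] is. *)
Definition witness (h : set nat -> set nat) :
    exponential NNO (nabla (set (set nat))) :=
  fun n A => [set k | k = n /\ A = [set p | h p n]]%classic.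

(** Equality in [nabla] carries no information: any number realizes it once it holds. Duplication,
    first projections and the identity therefore suffice. *)
Lemma witness_functional : exists r, forall h,
  functional (X := NNO) (Y := nabla (set (set nat))) (witness h) r.
Proof.
have [rS rSP] := rimp_computable (computable_pair computable_id computable_id).
have [rF rFP] := rimp_computable (computable_fst computable_id).
exists (npair rS (npair rF (npair rF (code_num code_id)))) => h.
apply: rand_npair; last apply: rand_npair; last apply: rand_npair.
- by move=> n _ A _; apply: rSP => k [-> _]; apply: rand_npair.
- move=> n _ n' _ A _ A' _; apply: rFP.
  move=> w [k [w' [Fk [i [j [[_ <-] <- _]]] ->]]].
  by rewrite nfstK.
- by move=> n _ A _ A' _; apply: rFP => w [k [l [[_ ->] [_ ->] _]]].
- move=> n _ k [-> _]; exists n; last by exists [set p | h p n]%classic.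
  by exists code_id => //; apply: ceval_id.
Qed.

Lemma to_join : exists r, forall h p,
  rimp (h p) (joinN (gr_at (witness h)) p) r.
Proof.
pose i := npair (code_num code_id) (code_num code_id).
(* The outer [a] realizes the existence of [n], the arbitrary 0 that of [theta n] in [nabla], the
   inner [a] the relation [witness h], and [i] the equivalence of [p] with itself. *)
have [r rP] : exists r, forall A B : set nat,
    (forall a, A a -> B (npair a (npair 0 (npair a i)))) -> rimp A B r.
  apply: rimp_computable.
  do ![apply: computable_id | apply: computable_const | apply: computable_pair].
exists r => h p; apply: rP => n hpn.
exists n => //; apply: rand_npair => //.
exists [set q | h q n]%classic => //; apply: rand_npair => //.
apply: rand_npair => //; exists p => //.
by apply: rand_npair; apply: rimp_id.
Qed.

Lemma from_join : exists c, forall h e p, ext h e ->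
  rimp (joinN (gr_at (witness h)) p) (h p) (code_num (curry c e)).
Proof.
have [U UP] := universal_code.
(* On input [npair e (npair n (npair b (npair n u)))], [d] extracts [npair e u] and [k] below
   extracts [n]; [U] runs [e] on [u], then the resulting [f] on [n]. *)
have [d dP] : computable (fun w => npair (nfst w) (nsnd (nsnd (nsnd (nsnd w))))).
  by apply: computable_pair; [|do 3 apply: computable_snd];
    do ?[apply: computable_fst | apply: computable_snd]; exact: computable_id.
have [k kP] : computable (fun w => nfst (nsnd w)).
  exact/computable_fst/computable_snd/computable_id.
exists (CComp U (CPair (CComp CFst (CComp U d)) k)) => h e p he.
apply: rimp_code => z [n _ [k' [w [[-> _] nw ->]]]].
move: nw => [A _ [b [w' [_ nw' ->]]]].
move: nw' => [l [u [[-> ->] [q hqn qpu] ->]]].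
have [v eu [f [g [hf hg vE]]]] := he q I p I u qpu.
have [y fy hpy] := hf n hqn.
exists y => //; apply: ceval_curry => /=.
exists (npair f n); last exact: UP.
exists f, n; split=> //; last by have := kP (npair e
  (npair n (npair b (npair n u)))); rewrite nsndK nfstK.
exists v; last by rewrite vE nfstK.
exists (npair e u); last exact: UP.
by have := dP (npair e (npair n (npair b (npair n u)))); rewrite nfstK !nsndK.
Qed.

Theorem proposition3p1p7 :
  Eff_models
    (rforall (X := OmegaOmega) (fun h =>
       rexists (X := exponential NNO (nabla (set (set nat)))) (fun theta =>
         equal OmegaOmega h (joinN (gr_at theta))))).
Proof.
have [rw rwP] := witness_functional.
have [rt rtP] := to_join.
have [c cP] := from_join.
(* The components realize, in order, functionality of [witness h], [ext h], and the two directions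
   of the pointwise equivalence. *)
have [r rP] : exists r, forall A B : set nat, (forall e, A e ->
    B (npair rw (npair e (npair rt (code_num (curry c e)))))) -> rimp A B r.
  apply: rimp_computable; do ![apply: computable_curry | apply: computable_id
    | apply: computable_const | apply: computable_pair].
exists (code_num (code_const r)) => _ _; apply: rimp_code => x _.
exists r; first exact: ceval_const.
move=> h _; apply: rP => e he; exists (witness h) => //.
apply: rand_npair; first exact: rwP.
apply: rand_npair => // p _; apply: rand_npair; first exact: rtP.
exact: cP.
Qed.
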